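(* (1) Let $\mathbb{K}$ be a field. For configurations over $\mathbb{K}$ of rank at most $3$, there are only finitely many contact equivalence classes; that is, the set of all configuration polynomials $\psi_W$, where $E$ ranges over finite sets and $W\subseteq\mathbb{K}^E$ over configurations with $\dim_{\mathbb{K}}W\le3$, consists of only finitely many contact equivalence classes. (2) For each integer $r\ge4$, there is an infinite family of configurations $W$ over $\mathbb{K}=\mathbb{Q}$ of rank $r$ whose configuration polynomials $\psi_W$ are pairwise not contact equivalent.
   Context: For a finite set $E$, $\mathbb{K}^E$ is the $\mathbb{K}$-vector space with canonical basis $E$; for $w\in\mathbb{K}^E$, $w_e$ denotes its $e$-component. A configuration is a $\mathbb{K}$-linear subspace $W\subseteq\mathbb{K}^E$; its rank is $\dim_{\mathbb{K}}W$. Configuration polynomial: for a basis $w^1,\dots,w^r$ of $W$ and variables $x=(x_e)_{e\in E}$, $\psi_W:=\det\left(\sum_{e\in E}x_e w^i_e w^j_e\right)_{1\le i,j\le r}\in\mathbb{K}[x]$; it is determined by $W$ up to a square factor in $\mathbb{K}^*$. (Linear) contact equivalence: polynomials $\phi\in\mathbb{K}[x_1,\dots,x_m]$ and $\psi\in\mathbb{K}[x_1,\dots,x_n]$ are contact equivalent, $\phi\simeq\psi$, if for some $p\ge m,n$ there are $\ell\in\operatorname{GL}_p(\mathbb{K})$ and $\lambda\in\mathbb{K}^*$ with $\phi=\lambda\cdot\psi\circ\ell$ in $\mathbb{K}[x_1,\dots,x_p]$. Configuration polynomials are compared by enumerating $E$ (the enumeration does not affect the equivalence class). *)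

(* Defs.v *)
From HB Require Import structures.
From mathcomp Require Import all_boot all_order all_algebra.
From mathcomp Require Export mpoly.

Set Implicit Arguments.
Unset Strict Implicit.
Unset Printing Implicit Defensive.

Import GRing.Theory.

Local Open Scope ring_scope.

Section Configurations.
Variables (K : fieldType) (E : finType).

(* The variables x_e live in {mpoly K[#|E|]}: x_e is 'X_(enum_rank e). *)
Definition config_matrix r (w : r.-tuple {ffun E -> K^o}) :
    'M[{mpoly K[#|E|]}]_r :=
  \matrix_(i, j)
    \sum_(e : E) ((tnth w i e : K) * (tnth w j e : K)) *: 'X_(enum_rank e).

(* psi_W depends on the choice of a basis, through a factor in (K^* )^2; no
   basis is singled out here. *)
Definition is_config_poly (W : {vspace {ffun E -> K^o}})
    (psi : {mpoly K[#|E|]}) : Prop :=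
  exists2 w : (\dim W).-tuple {ffun E -> K^o},
    basis_of W w & psi = \det (config_matrix w).

Lemma config_poly_exists (W : {vspace {ffun E -> K^o}}) :
  exists psi, is_config_poly W psi.
Proof.
by exists (\det (config_matrix (vbasis W))), (vbasis W); first exact: vbasisP.
Qed.

End Configurations.

Section ContactEquivalence.
Variable K : fieldType.

(* The inclusion K[x_1, ..., x_m] -> K[x_1, ..., x_p] for m <= p. *)
Definition mpoly_widen (m p : nat) (le_mp : (m <= p)%N) (phi : {mpoly K[m]}) :
    {mpoly K[p]} :=
  phi \mPo [tuple 'X_(widen_ord le_mp i) | i < m].

Definition linear_subst p (l : 'M[K]_p) (psi : {mpoly K[p]}) : {mpoly K[p]} :=
  psi \mPo [tuple \sum_(j < p) l i j *: 'X_j | i < p].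

Definition contact_equiv m n (phi : {mpoly K[m]}) (psi : {mpoly K[n]}) : Prop :=
  exists (p : nat) (le_mp : (m <= p)%N) (le_np : (n <= p)%N)
         (l : 'M[K]_p) (lambda : K),
    [/\ l \in unitmx, lambda != 0
      & mpoly_widen le_mp phi
        = lambda *: linear_subst l (mpoly_widen le_np psi)].

End ContactEquivalence.

(* Main.v *)
From HB Require Import structures.
Require Import Defs.
From mathcomp Require Import all_boot all_order all_algebra.
From mathcomp Require Import ring lra.

(* Up to contact equivalence, psi_W depends only on the linear span L of the
   rank one matrices w_e w_e^T, and on L only up to congruence.  A basis of the
   matroid moves the diagonal matrices into L, so that L is the sum of the
   diagonal matrices and a space M of symmetric matrices with zero diagonal.
   For r <= 3, M lives in K^3, is the span or the kernel of one vector, and the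
   diagonal congruences rescale the three coordinates independently: the vector
   can be taken in {0, 1}^3.

   For r = 4 + m, take the columns e_1, ..., e_r, u = (1,1,1,0,0,...) and
   v = (0,1,t,1,0,...).  The directions along which psi is affine are exactly
   the multiples of the basis vectors: on such a direction the principal minors
   of size at least 2 of the corresponding matrix of L vanish, and these r + 2
   are the only matrices of rank one in L.  A contact equivalence thus sends
   basis vectors to multiples of basis vectors, and preserves the set of
   quotients c_B c_B' / (c_B'' c_B''') of coefficients with B + B' = B'' + B'''
   as multisets.  This set is finite and contains t^2, so it suffices to let t
   grow fast enough. *)

Set Implicit Arguments.
Unset Strict Implicit.
Unset Printing Implicit Defensive.

(** * Determinants of pencils of symmetric matrices *)

Section Pencils.
Import GRing.Theory.
Local Open Scope ring_scope.
Variable K : fieldType.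

(** Row k of [A] is the vectorized k-th matrix of the pencil. The span of these matrices is thus the
    row space of [A], on which substitutions act from the left and congruences from the right. *)
Definition pencil m r (A : 'M[K]_(m, r * r)) : 'M[{mpoly K[m]}]_r :=
  \matrix_(i, j) \sum_k A k (mxvec_index i j) *: 'X_k.

Definition pencil_det m r (A : 'M[K]_(m, r * r)) : {mpoly K[m]} :=
  \det (pencil A).

Definition congr_mx r s (P : 'M[K]_(s, r)) : 'M[K]_(r * r, s * s) :=
  lin_mx (mulmxr P^T \o mulmx P).

Lemma mul_congr_mx r s (P : 'M[K]_(s, r)) (X : 'M[K]_r) :
  mxvec X *m congr_mx P = mxvec (P *m X *m P^T).
Proof. by rewrite /congr_mx mul_vec_lin. Qed.

Lemma congr_mxM r s t (P : 'M[K]_(s, r)) (Q : 'M[K]_(t, s)) :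
  congr_mx P *m congr_mx Q = congr_mx (Q *m P).
Proof.
apply/row_matrixP=> i; rewrite !rowE -[delta_mx _ _]vec_mxK mulmxA.
by rewrite !mul_congr_mx trmx_mul !mulmxA.
Qed.

Lemma congr_mx1 r : congr_mx (1%:M : 'M[K]_r) = 1%:M.
Proof.
apply/row_matrixP=> i; rewrite !rowE -[delta_mx _ _]vec_mxK.
by rewrite !mul_congr_mx trmx1 mulmx1 mul1mx mulmx1.
Qed.

Lemma pencil_det_subst m p r (A : 'M[K]_(m, r * r)) (l : 'M[K]_(m, p)) :
  pencil_det A \mPo [tuple \sum_(j < p) l i j *: 'X_j | i < m]
  = pencil_det (l^T *m A).
Proof.
rewrite /pencil_det -det_map_mx; congr (\det _).
apply/matrixP=> i j; rewrite !mxE rmorph_sum /=.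
under eq_bigr => k _ do
  rewrite comp_mpolyZ comp_mpolyXU -tnth_nth tnth_mktuple scaler_sumr.
rewrite exchange_big /=; apply: eq_bigr => k _.
rewrite mxE scaler_suml; apply: eq_bigr => k' _.
by rewrite scalerA mxE mulrC.
Qed.

Lemma pencil_det_congr m r (A : 'M[K]_(m, r * r)) (P : 'M[K]_r) :
  pencil_det (A *m congr_mx P) = (\det P ^+ 2) *: pencil_det A.
Proof.
have -> : pencil_det (A *m congr_mx P) =
   \det (map_mx (@mpolyC m K) P *m pencil A *m map_mx (@mpolyC m K) P^T).
  congr (\det _); apply/matrixP=> i j; rewrite !mxE.
  under eq_bigr => k _.
    have -> : (A *m congr_mx P) k (mxvec_index i j) =
       \sum_b \sum_a P i a * A k (mxvec_index a b) * P j b.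
      have -> : (A *m congr_mx P) k (mxvec_index i j)
         = (P *m vec_mx (row k A) *m P^T) i j.
        by rewrite -[RHS]mxvecE -mul_congr_mx vec_mxK -row_mul [in RHS]mxE.
      rewrite !mxE; apply: eq_bigr => b _; rewrite !mxE big_distrl /=.
      by apply: eq_bigr => a _; rewrite !mxE.
    over.
  under [RHS]eq_bigr => b _ do rewrite !mxE big_distrl /=.
  under eq_bigr => k _ do rewrite scaler_suml.
  rewrite exchange_big /=; apply: eq_bigr => b _.
  under eq_bigr => k _ do rewrite scaler_suml.
  rewrite exchange_big /=; apply: eq_bigr => a _.
  rewrite !mxE mulrAC -mpolyCM mul_mpolyC scaler_sumr.
  by apply: eq_bigr => k _; rewrite scalerA mulrAC.
rewrite !det_mulmx -map_trmx det_tr !det_map_mx /= mulrAC -mpolyCM mul_mpolyC.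
by rewrite expr2.
Qed.

Definition widen_mx m p (le_mp : (m <= p)%N) : 'M[K]_(p, m) :=
  \matrix_(k, i) (k == widen_ord le_mp i)%:R.

Lemma mpoly_widenE m p r (le_mp : (m <= p)%N) (A : 'M[K]_(m, r * r)) :
  mpoly_widen le_mp (pencil_det A) = pencil_det (widen_mx le_mp *m A).
Proof.
rewrite -[widen_mx _]trmxK -pencil_det_subst; congr (_ \mPo _).
apply: eq_mktuple => i.
rewrite (bigD1 (widen_ord le_mp i)) //= big1 ?addr0 => [|j /negPf ne];
  by rewrite !mxE ?eqxx ?scale1r ?ne ?scale0r.
Qed.

Lemma widen_mxK m p (le_mp : (m <= p)%N) :
  (widen_mx le_mp)^T *m widen_mx le_mp = 1%:M.
Proof.
apply/matrixP=> i j; rewrite !mxE (bigD1 (widen_ord le_mp i)) //= big1 ?addr0.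
  by rewrite !mxE eqxx mul1r -(inj_eq val_inj).
by move=> k /negPf ne; rewrite !mxE ne mul0r.
Qed.

Lemma widen_eqmx m p n (le_mp : (m <= p)%N) (A : 'M[K]_(m, n)) :
  (widen_mx le_mp *m A :=: A)%MS.
Proof.
apply/eqmxP; rewrite submxMl /=.
set D := widen_mx _; suff {1}-> : A = D^T *m (D *m A) by apply: submxMl.
by rewrite mulmxA widen_mxK mul1mx.
Qed.

(** Padded with zero rows to the same height, matrices with equal row spaces differ by an invertible
    left factor, which is the substitution. The congruence contributes the square of [\det P],
    absorbed by lambda. *)
Lemma pencil_contact_equiv m n r (A : 'M[K]_(m, r * r)) (B : 'M[K]_(n, r * r))
    (P : 'M[K]_r) :
  P \in unitmx -> (A *m congr_mx P :=: B)%MS ->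
  contact_equiv (pencil_det A) (pencil_det B).
Proof.
move=> Pu eqAB; exists (maxn m n), (leq_maxl m n), (leq_maxr m n).
have /eqmxMunitP[l lu El] : (widen_mx (leq_maxl m n) *m (A *m congr_mx P)
                             == widen_mx (leq_maxr m n) *m B)%MS.
  apply/eqmxP; apply: (eqmx_trans (widen_eqmx _ _)).
  by apply: (eqmx_trans eqAB); apply/eqmx_sym/widen_eqmx.
exists l^T, (\det P ^- 2).
have dP : \det P != 0 by rewrite -unitfE -unitmxE.
split; rewrite ?unitmx_tr ?invr_eq0 ?expf_eq0 ?(negPf dP) //.
rewrite /linear_subst !mpoly_widenE pencil_det_subst trmxK -El.
by rewrite mulmxA pencil_det_congr scalerA mulVf ?expf_neq0 // scale1r.
Qed.

(* In 'I_3 = Z/3, the index distinct from i and j is -(i + j) when i <> j. *)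
Definition off_diag (v : 'rV[K]_3) : 'M[K]_3 :=
  \matrix_(i, j) if i == j then 0 else v 0 (- (i + j)).

Fact off_diag_is_linear : linear off_diag.
Proof.
move=> c u v; apply/matrixP=> i j; rewrite !mxE.
by case: eqP; rewrite ?mulr0 ?addr0.
Qed.
HB.instance Definition _ :=
  GRing.isLinear.Build K 'rV[K]_3 'M[K]_3 _ off_diag off_diag_is_linear.

Definition diag_gens r : 'M[K]_(r, r * r) := lin1_mx (mxvec \o diag_mx).
Definition off_gens : 'M[K]_(3, 3 * 3) := lin1_mx (mxvec \o off_diag).

Lemma mul_diag_gens r (d : 'rV[K]_r) : d *m diag_gens r = mxvec (diag_mx d).
Proof. exact: mul_rV_lin1. Qed.

Lemma mul_off_gens v : v *m off_gens = mxvec (off_diag v).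
Proof. exact: mul_rV_lin1. Qed.

Lemma sym3_decomp (X : 'M[K]_3) : X^T = X ->
  X = diag_mx (\row_k X k k) + off_diag (\row_k X (k + 1) (k + 1 + 1)).
Proof.
move=> /matrixP sX; apply/matrixP=> i j; rewrite !mxE.
have sXij a b : X a b = X b a by rewrite -[LHS]sX mxE.
case: (eqVneq i j) => [->|ne]; first by rewrite addr0 mulr1n.
rewrite mulr0n add0r.
(* The position (i, j) is (k + 1, k + 2) or its transpose, for k = -(i + j) in Z/3. *)
have [-> //|->] : X i j = X (- (i + j) + 1) (- (i + j) + 1 + 1)
  \/ X i j = X (- (i + j) + 1 + 1) (- (i + j) + 1); last exact: sXij.
case: i j ne => [[|[|[|//]]] ?] [[|[|[|//]]] ?] // _;
  (by left; congr (X _ _); apply: val_inj) ||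
  (by right; congr (X _ _); apply: val_inj).
Qed.

Lemma off_diag_torus (d v : 'rV[K]_3) : (forall k, d 0 k != 0) ->
  diag_mx d *m off_diag v *m (diag_mx d)^T
  = (\prod_k d 0 k) *: off_diag (v *m diag_mx (\row_k (d 0 k)^-1)).
Proof.
move=> d0; apply/matrixP=> i j; rewrite tr_diag_mx mul_mx_diag mul_diag_mx !mxE.
case: (eqVneq i j) => [|ne]; first by rewrite !(mulr0, mul0r).
have -> : \prod_k d 0 k = d 0 i * d 0 j * d 0 (- (i + j)).
  rewrite (bigD1 i) //= (bigD1 j) 1?eq_sym //= (bigD1 (- (i + j))) /=.
    rewrite big1 ?mulr1 ?mulrA // => k.
    by case: i j k ne => [[|[|[|//]]] ?] [[|[|[|//]]] ?] [[|[|[|//]]] ?].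
  by case: i j ne => [[|[|[|//]]] ?] [[|[|[|//]]] ?].
rewrite (bigD1 (- (i + j))) //= big1 ?addr0 => [|k /negPf nk].
  by rewrite !mxE eqxx mulr1n; field.
by rewrite !mxE nk mulr0n mulr0.
Qed.

End Pencils.

(** * Normal forms in rank at most three *)

Section NormalForms.
Import GRing.Theory.
Local Open Scope ring_scope.
Variable K : fieldType.

Lemma rank_le1_eqmx m n (M : 'M[K]_(m, n)) :
  (\rank M <= 1)%N -> (M :=: nz_row M)%MS.
Proof.
move=> rM; apply/eqmx_sym/eqmxP; rewrite -(mxrank_leqif_eq (nz_row_sub M)).
rewrite eqn_leq mxrankS ?nz_row_sub //= rank_rV nz_row_eq0.
by case: (eqVneq M 0) => [->|_]; rewrite ?mxrank0.
Qed.

(** Rank at most one gives a line or 0. Otherwise the annihilator has rank at most one, and [M] is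
    the kernel of its generator; [u = 0] covers the whole space. *)
Lemma line_or_kernel m (M : 'M[K]_(m, 3)) :
  (exists v : 'rV_3, (M :=: v)%MS) \/ (exists u : 'rV_3, (M :=: kermx u^T)%MS).
Proof.
case: (leqP (\rank M) 1) => rM; first by left; exists (nz_row M); exact: rank_le1_eqmx.
right; pose N := kermx M^T.
have rN : \rank N = (3 - \rank M)%N by rewrite mxrank_ker mxrank_tr.
have eqN : (N :=: nz_row N)%MS.
  by apply: rank_le1_eqmx; rewrite rN leq_subLR addn1.
exists (nz_row N).
have sub : (M <= kermx (nz_row N)^T)%MS.
  apply/sub_kermxP; have /submxP[D ->] : (nz_row N <= N)%MS by rewrite nz_row_sub.
  rewrite trmx_mul mulmxA (_ : M *m N^T = 0) ?mul0mx //.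
  by apply: trmx_inj; rewrite trmx_mul trmxK trmx0 mulmx_ker.
apply/eqmxP; rewrite -(mxrank_leqif_eq sub) mxrank_ker mxrank_tr -eqN rN.
by rewrite subKn // rank_leq_col.
Qed.

(** These are at most 16 subspaces. [<<_>>] makes the line a square matrix, so that both cases have
    the same type. *)
Definition normal_form (b : bool) (e : {ffun 'I_3 -> bool}) : 'M[K]_3 :=
  if b then kermx (\row_k (e k)%:R)^T else <<\row_k (e k)%:R>>%MS.

Lemma diag_mx_unit n (c : 'rV[K]_n) :
  (forall k, c 0 k != 0) -> diag_mx c \in unitmx.
Proof.
move=> c0; rewrite unitmxE det_diag unitfE.
by apply/prodf_neq0 => k _.
Qed.

(* Multiplying c by a scalar does not matter, and the congruence by diag(d)
   scales the coordinate k of off_diag by (d_0 d_1 d_2) / d_k: every c is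
   realized by the torus. *)
Lemma torus_normal_form m (M : 'M[K]_(m, 3)) :
  exists c : 'rV_3, (forall k, c 0 k != 0) /\
  exists b e, (M *m diag_mx c :=: normal_form b e)%MS.
Proof.
(* [nz] replaces zero coordinates by 1, so that dividing by it turns v into the indicator of its
   support. *)
pose nz (v : 'rV[K]_3) k := if v 0 k == 0 then 1 else v 0 k.
have nz0 v k : nz v k != 0 by rewrite /nz; case: ifP => [_|->//]; apply: oner_neq0.
have nzE (v : 'rV[K]_3) k : v 0 k * (nz v k)^-1 = (v 0 k != 0)%:R.
  by rewrite /nz; case: eqVneq => [->|?]; rewrite ?mul0r // divff.
case: (line_or_kernel M) => [] [v Ev].
  exists (\row_k (nz v k)^-1); split; first by move=> k; rewrite mxE invr_eq0.
  exists false, [ffun k => v 0 k != 0].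
  apply: (eqmx_trans (eqmxMr _ Ev)); apply/eqmx_sym/(eqmx_trans (genmxE _)).
  suff -> : v *m diag_mx (\row_k (nz v k)^-1) = \row_k ([ffun k => v 0 k != 0] k)%:R.
    by [].
  by apply/rowP=> k; rewrite mul_mx_diag !mxE ffunE nzE.
(* The vector defining a kernel transforms inversely to the vectors in it, so here the scaling is by
   [nz] itself. *)
exists (\row_k nz v k); split; first by move=> k; rewrite mxE.
exists true, [ffun k => v 0 k != 0].
set w := \row_k _; rewrite /normal_form; set e := \row_k _.
have Ew : diag_mx w *m e^T = v^T.
  apply/colP=> k; rewrite mul_diag_mx !mxE ffunE -nzE.
  by rewrite mulrC divfK.
have wu : diag_mx w \in unitmx by apply: diag_mx_unit => k; rewrite mxE.
apply: (eqmx_trans (eqmxMr _ Ev)).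
have sub : (kermx v^T *m diag_mx w <= kermx e^T)%MS.
  by apply/sub_kermxP; rewrite -mulmxA Ew mulmx_ker.
apply/eqmxP; rewrite -(mxrank_leqif_eq sub) mxrankMfree ?row_free_unit //.
by rewrite !mxrank_ker -Ew eqmxMfull // row_full_unit.
Qed.

Definition std_pencil b e : 'M[K]_(3 + 3, 3 * 3) :=
  col_mx (diag_gens K 3) (normal_form b e *m off_gens K).

Definition symmetric_pencil m r (A : 'M[K]_(m, r * r)) :=
  forall k, (vec_mx (row k A))^T = vec_mx (row k A).

Lemma diag_gens_torus r (d : 'rV[K]_r) : (forall k, d 0 k != 0) ->
  (diag_gens K r *m congr_mx (diag_mx d) :=: diag_gens K r)%MS.
Proof.
move=> d0.
have -> : diag_gens K r *m congr_mx (diag_mx d)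
    = diag_mx (\row_k (d 0 k ^+ 2)) *m diag_gens K r.
  apply/row_matrixP=> i; rewrite !rowE !mulmxA !mul_diag_gens mul_congr_mx.
  apply: (congr1 mxvec); apply/matrixP=> a b.
  rewrite tr_diag_mx mul_mx_diag mul_diag_mx mul_mx_diag !mxE.
  case: (eqVneq a b) => [->|_]; last by rewrite !mulr0n mulr0 mul0r.
  by rewrite !mulr1n; ring.
by apply/eqmxMfull; rewrite row_full_unit diag_mx_unit // => k; rewrite mxE expf_neq0.
Qed.

(** Modulo the diagonal matrices, only the off-diagonal parts of the rows of [A] matter; the torus
    normalizes their span and preserves the space of diagonal matrices. *)
Lemma symmetric_pencil_normal_form m (A : 'M[K]_(m, 3 * 3)) :
  symmetric_pencil A -> exists d : 'rV_3, (forall k, d 0 k != 0) /\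
  exists b e,
  (col_mx (diag_gens K 3) A *m congr_mx (diag_mx d) :=: std_pencil b e)%MS.
Proof.
move=> sA.
pose M := \matrix_(k < m) (\row_l vec_mx (row k A) (l + 1) (l + 1 + 1)).
pose D := \matrix_(k < m) (\row_l vec_mx (row k A) l l).
have EA : A = D *m diag_gens K 3 + M *m off_gens K.
  apply/row_matrixP=> k; rewrite linearD /= !row_mul !rowK mul_diag_gens.
  by rewrite mul_off_gens -[LHS]vec_mxK {1}(sym3_decomp (sA k)) linearD.
have [c [c0 [b [e Mc]]]] := torus_normal_form M.
(* The torus acts on off-diagonal coordinates through the inverse of d, up to the common factor
   [\prod_k d 0 k]. *)
exists (\row_k (c 0 k)^-1); split; first by move=> k; rewrite mxE invr_eq0.
exists b, e; set d := \row_k _.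
have d0 k : d 0 k != 0 by rewrite mxE invr_eq0.
have offE : off_gens K *m congr_mx (diag_mx d)
          = (\prod_k d 0 k) *: (diag_mx c *m off_gens K).
  apply/row_matrixP=> i; rewrite linearZ /= !rowE !mulmxA !mul_off_gens mul_congr_mx.
  rewrite off_diag_torus // linearZ; congr (_ *: mxvec (off_diag (_ *m diag_mx _))).
  by apply/rowP=> k; rewrite !mxE invrK.
rewrite mul_col_mx; apply: (eqmx_trans (eqmx_sym (addsmxE _ _))).
apply/eqmx_sym/(eqmx_trans (eqmx_sym (addsmxE _ _)))/eqmx_sym.
rewrite EA mulmxDl -!mulmxA offE.
set Dg := diag_gens K 3; set T := congr_mx _.
have DgT : (Dg *m T :=: Dg)%MS by apply: diag_gens_torus.
rewrite -scalemxAr !mulmxA.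
set X := M *m _ *m _; have pd : \prod_k d 0 k != 0 by apply/prodf_neq0.
have EX : (X :=: normal_form b e *m off_gens K)%MS by apply: eqmxMr.
apply/eqmxP/andP; split; rewrite addsmx_sub.
  rewrite DgT addsmxSl /=; apply: addmx_sub; last first.
    by rewrite scalemx_sub // EX addsmxSr.
  rewrite -mulmxA; apply: (submx_trans (submxMl _ _)).
  by rewrite DgT addsmxSl.
rewrite -{1}DgT addsmxSl /= -EX.
have EX' : X = (\prod_k d 0 k)^-1 *:
    ((D *m Dg *m T + (\prod_k d 0 k) *: X) - D *m (Dg *m T)).
  by rewrite mulmxA addrAC subrr add0r scalerA mulVf ?scale1r.
rewrite {1}EX'; apply: scalemx_sub; apply: addmx_sub; first by rewrite addsmxSr.
by rewrite eqmx_opp; apply: (submx_trans (submxMl _ _)); rewrite addsmxSl.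
Qed.

End NormalForms.

(** * Configurations of rank at most three *)

Section Configurations.
Import GRing.Theory.
Local Open Scope ring_scope.
Variable K : fieldType.

(** For [r <= 3], congruence by this matrix pads an r by r matrix with zeros to size 3, and
    congruence by its transpose cuts it back: all small ranks reduce to size 3. *)
Definition coord_incl r : 'M[K]_(3, r) := \matrix_(i, j) (i == j :> nat)%:R.

Lemma coord_inclK r : (r <= 3)%N -> (coord_incl r)^T *m coord_incl r = 1%:M.
Proof.
move=> r3; apply/matrixP=> i j; rewrite !mxE (bigD1 (widen_ord r3 i)) //=.
rewrite big1 ?addr0 => [|k nk]; first by rewrite !mxE eqxx mul1r.
by rewrite !mxE -[_ == _ :> nat]/(k == widen_ord r3 i) (negPf nk) mul0r.
Qed.

Lemma coord_incl_diag r (d : 'rV[K]_3) :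
  (coord_incl r)^T *m diag_mx d = diag_mx (d *m coord_incl r) *m (coord_incl r)^T.
Proof.
apply/matrixP=> i j; rewrite mul_mx_diag mul_diag_mx !mxE.
case: eqP => [e|]; rewrite ?mul0r ?mulr0 // mulr1 mul1r.
rewrite (bigD1 j) //= big1 ?addr0 => [|k nk]; first by rewrite !mxE e eqxx mulr1.
rewrite mxE -e; case: eqP; rewrite ?mulr0 // => /val_inj kj.
by rewrite kj eqxx in nk.
Qed.

Lemma diag_gens_coord_incl r :
  (diag_gens K 3 *m congr_mx (coord_incl r)^T <= diag_gens K r)%MS.
Proof.
apply/row_subP=> i; rewrite rowE mulmxA mul_diag_gens mul_congr_mx trmxK.
rewrite coord_incl_diag.
suff -> : diag_mx (delta_mx 0 i *m coord_incl r) *m (coord_incl r)^T *m coord_incl r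
  = diag_mx (delta_mx 0 i *m coord_incl r).
  by rewrite -mul_diag_gens submxMl.
apply/matrixP=> a b; rewrite mxE.
rewrite (bigD1 i) //= big1 ?addr0 => [|k nk].
  rewrite !mul_diag_mx !mxE; rewrite (bigD1 i) //= big1 ?addr0 => [|k nk]; last first.
    by rewrite !mxE (negPf nk) andbF mul0r.
  rewrite !mxE !eqxx mul1r; case: (eqVneq a b) => [->|nab]; last first.
    rewrite mulr0n; case: eqP => [e|_]; rewrite ?mul0r // mul1r.
    case: eqP => [e'|_]; rewrite ?mulr0 //.
    by case/eqP: nab; apply: val_inj; rewrite /= -e -e'.
  by rewrite mulr1n; case: eqP; rewrite ?mul0r ?mul1r.
rewrite !mul_diag_mx !mxE (bigD1 i) //= big1 ?addr0 => [|l nl]; last first.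
  by rewrite !mxE (negPf nl) andbF mul0r.
rewrite !mxE !eqxx mul1r; case: (eqVneq (i : nat) a) => [e|_]; last by rewrite !mul0r.
case: eqP => [e'|_]; last by rewrite mulr0 mul0r.
by case/eqP: nk; apply: val_inj; rewrite /= e' -e.
Qed.

Definition normal_pencil r (t : bool * {ffun 'I_3 -> bool}) : 'M[K]_(3 + 3, r * r) :=
  std_pencil K t.1 t.2 *m congr_mx (coord_incl r)^T.

(** Pad to size 3, adjoin all diagonal matrices, normalize by the torus, and cut back. The adjoined
    matrices are cut to diagonal ones, which the row space of [A] already contains. *)
Lemma pencil_normal_form m r (A : 'M[K]_(m, r * r)) :
  (r <= 3)%N -> symmetric_pencil A -> (diag_gens K r <= A)%MS ->
  exists2 Q : 'M_r, Q \in unitmx &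
  exists t, (A *m congr_mx Q :=: normal_pencil r t)%MS.
Proof.
move=> r3 sA dA; set T := coord_incl r.
have sB : symmetric_pencil (A *m congr_mx T).
  move=> k; rewrite row_mul -[row k A]vec_mxK mul_congr_mx mxvecK.
  by rewrite !trmx_mul trmxK sA mulmxA.
have [d [d0 [b [e Bd]]]] := symmetric_pencil_normal_form sB.
have dT k : (d *m T) 0 k != 0.
  rewrite mxE (bigD1 (widen_ord r3 k)) //= big1 ?addr0 => [|l nl].
    by rewrite mxE eqxx mulr1.
  rewrite mxE -[_ == _ :> nat]/(l == widen_ord r3 k) (negPf nl) mulr0 //.
exists (diag_mx (d *m T)); first exact: diag_mx_unit.
exists (b, e); apply: eqmx_trans (eqmxMr _ Bd).
rewrite -mulmxA congr_mxM coord_incl_diag -congr_mxM mulmxA; apply: eqmxMr.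
rewrite mul_col_mx -mulmxA congr_mxM coord_inclK // congr_mx1 mulmx1.
apply: eqmx_trans (addsmxE _ _); apply/eqmx_sym/addsmx_idPr.
exact: submx_trans (diag_gens_coord_incl _) dA.
Qed.

Variable E : finType.

Definition coef_mx r (w : r.-tuple {ffun E -> K^o}) : 'M[K]_(r, #|E|) :=
  \matrix_(i, k) (tnth w i (enum_val k) : K).

Definition config_pencil r (w : r.-tuple {ffun E -> K^o}) : 'M[K]_(#|E|, r * r) :=
  \matrix_k mxvec (col k (coef_mx w) *m (col k (coef_mx w))^T).

Lemma config_matrixE r (w : r.-tuple {ffun E -> K^o}) :
  config_matrix w = pencil (config_pencil w).
Proof.
apply/matrixP=> i j; rewrite !mxE (reindex (@enum_val E E)) /=; last first.
  by apply: onW_bij; apply: enum_val_bij.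
apply: eq_bigr => k _; rewrite enum_valK; congr (_ *: _).
by rewrite mxE mxvecE mxE big_ord1 !mxE.
Qed.

Lemma coef_mx_row_free r (w : r.-tuple {ffun E -> K^o}) :
  free w -> row_free (coef_mx w).
Proof.
move=> /freeP fw; rewrite -kermx_eq0; apply/eqP/row_matrixP=> i0; rewrite row0.
set v := row i0 _; apply/rowP=> i; rewrite [RHS]mxE; apply: (fw (v 0)).
apply/ffunP=> e; rewrite sum_ffunE ffunE.
have : (v *m coef_mx w) 0 (enum_rank e) = 0.
  by rewrite -row_mul mulmx_ker row0 mxE.
rewrite mxE => {2}<-; apply: eq_bigr => j _.
by rewrite !mxE ffunE enum_rankK -tnth_nth.
Qed.

Lemma config_pencil_normal_form r (w : r.-tuple {ffun E -> K^o}) :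
  (r <= 3)%N -> free w ->
  exists t, contact_equiv (\det (config_matrix w)) (pencil_det (normal_pencil r t)).
Proof.
move=> r3 fw; rewrite config_matrixE -[\det _]/(pencil_det _).
set A := config_pencil w.
have full : row_full (coef_mx w)^T.
  by rewrite /row_full mxrank_tr; apply: coef_mx_row_free.
(* [f] selects a basis of the matroid. The inverse of the corresponding submatrix turns these
   columns into standard basis vectors, whose rank one matrices generate the diagonal ones. *)
pose f := fullrankfun full; pose N := rowsub f (coef_mx w)^T.
have Nu : N^T \in unitmx.
  by rewrite unitmx_tr -row_full_unit fullrowsub_full.
have fE j : invmx N^T *m col (f j) (coef_mx w) = delta_mx j 0.
  suff -> : col (f j) (coef_mx w) = col j N^T by rewrite colE mulKmx.
  by apply/colP=> i; rewrite !mxE.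
have sA : symmetric_pencil (A *m congr_mx (invmx N^T)).
  move=> k; rewrite row_mul rowK mul_congr_mx mxvecK.
  by rewrite !trmx_mul !trmxK !mulmxA.
have dA : (diag_gens K r <= A *m congr_mx (invmx N^T))%MS.
  apply/row_subP=> j.
  suff -> : row j (diag_gens K r) = row (f j) (A *m congr_mx (invmx N^T)).
    exact: row_sub.
  rewrite row_mul rowK mul_congr_mx mulmxA fE -mulmxA -trmx_mul fE rowE.
  rewrite mul_diag_gens; congr (mxvec _); apply/matrixP=> a b.
  rewrite !mxE big_ord1 !mxE !eqxx /= !andbT.
  case: (eqVneq a j) => [->|_]; last by rewrite mul0r mul0rn.
  by rewrite mul1r eq_sym; case: eqP.
have [Q Qu [t Et]] := pencil_normal_form r3 sA dA.
exists t; apply: (@pencil_contact_equiv _ _ _ _ _ _ (Q *m invmx N^T)).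
  by rewrite unitmx_mul Qu unitmx_inv.
by rewrite -congr_mxM mulmxA.
Qed.

End Configurations.

Lemma finitely_many_classes (K : GRing.Field.type) :
     exists (N : nat) (phi : 'I_N -> {n : nat & {mpoly K[n]}}),
       forall (E : finType) (W : {vspace {ffun E -> K^o}})
              (psi : {mpoly K[#|E|]}),
         \dim W <= 3 -> is_config_poly W psi ->
         exists i : 'I_N, contact_equiv psi (projT2 (phi i)).
Proof.
(* One representative for each rank below 4 and each code of a normal form. *)
pose I : finType := ('I_4 * (bool * {ffun 'I_3 -> bool}))%type.
exists #|I|, (fun i : 'I_#|I| => existT (fun n => {mpoly K[n]}) (3 + 3)
  (pencil_det (normal_pencil K (enum_val i : I).1 (enum_val i : I).2))).
move=> E W psi r3 [w bw ->].
have [t Et] := config_pencil_normal_form r3 (basis_free bw).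
exists (enum_rank ((Ordinal (r3 : \dim W < 4), t) : I)).
by rewrite enum_rankK.
Qed.

(** * A pencil of quartics with six rank one points *)

Section Quartic.
Import GRing.Theory Num.Theory Order.TTheory.
Local Open Scope ring_scope.

(** This is the Cauchy-Binet expansion of the configuration polynomial of [config4]: each
    coefficient is a squared maximal minor, and two of the 15 minors vanish identically. *)
Definition quartic (t : rat) (x : nat -> rat) : rat :=
  x 0 * x 1 * x 2 * x 3
  + x 4 * (x 1 * x 2 * x 3 + x 0 * x 2 * x 3 + x 0 * x 1 * x 3)
  + x 5 * (x 0 * x 2 * x 3 + t ^+ 2 * x 0 * x 1 * x 3 + x 0 * x 1 * x 2)
  + x 4 * x 5 * (x 2 * x 3 + t ^+ 2 * x 1 * x 3 + x 1 * x 2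
                 + (t - 1) ^+ 2 * x 0 * x 3 + x 0 * x 2 + x 0 * x 1).

Definition quartic_affine t (v : nat -> rat) := forall x s,
  quartic t (fun i => x i + s * v i) - quartic t x
  = s * (quartic t (fun i => x i + v i) - quartic t x).

(** Matrices given by functions on [nat] keep this form in cofactors, so that Laplace expansions can
    be iterated by rewriting. *)
Lemma cofactor_fun (R : comNzRingType) n (a : nat -> nat -> R) i j :
  cofactor (\matrix_(i < n, j < n) a i j) i j
  = (-1) ^+ (i + j) * \det (\matrix_(k < n.-1, l < n.-1) a (bump i k) (bump j l)).
Proof. by congr (_ * \det _); apply/matrixP=> k l; rewrite !mxE. Qed.

Lemma det_mx3 (R : comNzRingType) (a : nat -> nat -> R) :
  \det (\matrix_(i < 3, j < 3) a i j) =
    a 0 0 * (a 1 1 * a 2 2 - a 1 2 * a 2 1)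
  - a 0 1 * (a 1 0 * a 2 2 - a 1 2 * a 2 0)
  + a 0 2 * (a 1 0 * a 2 1 - a 1 1 * a 2 0).
Proof.
rewrite (expand_det_row _ ord0) !big_ord_recl big_ord0 !cofactor_fun.
rewrite !(expand_det_row _ (ord0 : 'I_2)) !big_ord_recl !big_ord0.
rewrite !(cofactor_fun (fun k l => a (bump _ k) (bump _ l))).
rewrite !det_mx11 !mxE /= /bump /=; ring.
Qed.

Lemma det_mx4 (R : comNzRingType) (a : nat -> nat -> R) :
  \det (\matrix_(i < 4, j < 4) a i j) =
    a 0 0 * (a 1 1 * (a 2 2 * a 3 3 - a 2 3 * a 3 2)
             - a 1 2 * (a 2 1 * a 3 3 - a 2 3 * a 3 1)
             + a 1 3 * (a 2 1 * a 3 2 - a 2 2 * a 3 1))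
  - a 0 1 * (a 1 0 * (a 2 2 * a 3 3 - a 2 3 * a 3 2)
             - a 1 2 * (a 2 0 * a 3 3 - a 2 3 * a 3 0)
             + a 1 3 * (a 2 0 * a 3 2 - a 2 2 * a 3 0))
  + a 0 2 * (a 1 0 * (a 2 1 * a 3 3 - a 2 3 * a 3 1)
             - a 1 1 * (a 2 0 * a 3 3 - a 2 3 * a 3 0)
             + a 1 3 * (a 2 0 * a 3 1 - a 2 1 * a 3 0))
  - a 0 3 * (a 1 0 * (a 2 1 * a 3 2 - a 2 2 * a 3 1)
             - a 1 1 * (a 2 0 * a 3 2 - a 2 2 * a 3 0)
             + a 1 2 * (a 2 0 * a 3 1 - a 2 1 * a 3 0)).
Proof.
rewrite (expand_det_row _ ord0) !big_ord_recl big_ord0 !cofactor_fun.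
rewrite !(det_mx3 (fun k l => a (bump _ k) (bump _ l))) !mxE /= /bump /=; ring.
Qed.

Definition config4 (t : rat) : 'M[rat]_(4, 6) := \matrix_(i, j)
  nth 0 (nth [::] [:: [:: 1; 0; 0; 0; 1; 0]; [:: 0; 1; 0; 0; 1; 1];
                      [:: 0; 0; 1; 0; 1; t]; [:: 0; 0; 0; 1; 0; 1]] i) j.

Lemma det_config4 t (x : nat -> rat) :
  \det (config4 t *m diag_mx (\row_k x k) *m (config4 t)^T) = quartic t x.
Proof.
pose a i j := nth 0 (nth [::]
  [:: [:: x 0 + x 4; x 4; x 4; 0];
      [:: x 4; x 1 + x 4 + x 5; x 4 + t * x 5; x 5];
      [:: x 4; x 4 + t * x 5; x 2 + x 4 + t ^+ 2 * x 5; t * x 5];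
      [:: 0; x 5; t * x 5; x 3 + x 5]] i) j.
have -> : config4 t *m diag_mx (\row_k x k) *m (config4 t)^T
   = \matrix_(i < 4, j < 4) a i j.
  apply/matrixP=> i j; rewrite mul_mx_diag !mxE !big_ord_recl big_ord0 !mxE.
  by case: i j => [[|[|[|[|//]]]] ?] [[|[|[|[|//]]]] ?]; rewrite /= /bump /a /=; ring.
rewrite det_mx4 /a /= /quartic; ring.
Qed.

Lemma quartic_affineP t v : t != 0 -> quartic_affine t v ->
  exists2 i, (i < 6)%N & forall j, (j < 6)%N -> j != i -> v j = 0.
Proof.
move=> t0 aff; pose e a b c d i : rat := nth 0 [:: a; b; c; d] i.
(* For x a sum of two of the first four basis vectors, the coefficient of s^2
   in quartic t (x + s v) is a principal 2-minor of the symmetric matrix with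
   diagonal V and off-diagonal entries v4, v4, 0, v4 + t v5, v5, t v5; for x a
   single one, the coefficient of s^3 is a principal 3-minor. *)
have h a b c d := conj (aff (e a b c d) 2)
  (conj (aff (e a b c d) 3) (aff (e a b c d) (-1))).
pose V0 := v 0 + v 4; pose V1 := v 1 + v 4 + v 5.
pose V2 := v 2 + v 4 + t ^+ 2 * v 5; pose V3 := v 3 + v 5.
(* Along v the quartic has degree at most 4 in s. The three values of s in [h], together with 0 and
   1, force its coefficients from s^2 on to vanish, so each minor follows by linear arithmetic. *)
have m01 : V0 * V1 = v 4 ^+ 2.
  by have [+ []] := h 0 0 1 1; rewrite /quartic /e /= /V0 /V1; lra.
have m02 : V0 * V2 = v 4 ^+ 2.
  by have [+ []] := h 0 1 0 1; rewrite /quartic /e /= /V0 /V2; lra.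
have m03 : V0 * V3 = 0.
  by have [+ []] := h 0 1 1 0; rewrite /quartic /e /= /V0 /V3; lra.
have m12 : V1 * V2 = (v 4 + t * v 5) ^+ 2.
  by have [+ []] := h 1 0 0 1; rewrite /quartic /e /= /V1 /V2; lra.
have m13 : V1 * V3 = v 5 ^+ 2.
  by have [+ []] := h 1 0 1 0; rewrite /quartic /e /= /V1 /V3; lra.
have m23 : V2 * V3 = (t * v 5) ^+ 2.
  by have [+ []] := h 1 1 0 0; rewrite /quartic /e /= /V2 /V3; lra.
have m123 : V1 * V2 * V3 + 2 * (v 4 + t * v 5) * v 5 * (t * v 5)
    = V1 * (t * v 5) ^+ 2 + V2 * v 5 ^+ 2 + V3 * (v 4 + t * v 5) ^+ 2.
  by have [+ []] := h 1 0 0 0; rewrite /quartic /e /= /V1 /V2 /V3; lra.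
have m012 : V0 * V1 * V2 + 2 * v 4 * v 4 * (v 4 + t * v 5)
    = V0 * (v 4 + t * v 5) ^+ 2 + V1 * v 4 ^+ 2 + V2 * v 4 ^+ 2.
  by have [+ []] := h 0 0 0 1; rewrite /quartic /e /= /V0 /V1 /V2; lra.
have ex i : (i < 6)%N -> (forall j, j \in iota 0 6 -> j != i -> v j = 0) ->
    exists2 i, (i < 6)%N & forall j, (j < 6)%N -> j != i -> v j = 0.
  by move=> i6 vi; exists i => // j j6; apply: vi; rewrite mem_iota.
have sqr0 (a : rat) : a ^+ 2 = 0 -> a = 0 by move/eqP; rewrite sqrf_eq0 => /eqP.
have diag3 a b c : v a * v b = 0 -> v a * v c = 0 -> v b * v c = 0 ->
    exists i, [/\ i \in [:: a; b; c], i != a -> v a = 0, i != b -> v b = 0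
                & i != c -> v c = 0].
  move=> /eqP; rewrite mulf_eq0 => /orP[] /eqP ab /eqP; rewrite mulf_eq0.
    case/orP=> /eqP ac /eqP; rewrite mulf_eq0.
      case/orP=> /eqP bc; [exists c | exists b]; rewrite !inE eqxx ?orbT;
        by split=> //; move/eqP.
    by move=> _; exists b; rewrite !inE eqxx ?orbT; split=> //; move/eqP.
  case/orP=> /eqP ac /eqP; rewrite mulf_eq0.
    by move=> _; exists c; rewrite !inE eqxx ?orbT; split=> //; move/eqP.
  by move=> _; exists a; rewrite !inE eqxx ?orbT; split=> //; move/eqP.
(* The minor on rows 0 and 3 kills [v 4] or [v 5]. If the other one vanishes too, the symmetric
   matrix is diagonal and [diag3] leaves at most one entry; if not, the 2-minors determine its
   diagonal up to a sign. *)
move/eqP: m03; rewrite mulf_eq0 => /orP[] /eqP E0.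
  have v4 : v 4 = 0 by apply: sqr0; rewrite -m01 E0 mul0r.
  have v0 : v 0 = 0 by rewrite -E0 /V0 v4 addr0.
  rewrite !v4 ?add0r in m12 m123.
  have [v5|v5] := eqVneq (v 5) 0.
    have [||| i [i3 i1 i2 i3']] := @diag3 1 2 3.
    - by move: m12; rewrite /V1 /V2 v4 v5 !mulr0 !addr0 expr0n.
    - by move: m13; rewrite /V1 /V3 v4 v5 !addr0 expr0n.
    - by move: m23; rewrite /V2 /V3 v4 v5 !mulr0 !addr0 expr0n.
    apply: (ex i); first by move: i3; rewrite !inE => /or3P[] /eqP ->.
    move=> j; rewrite !inE => /or4P[||| /or3P[]] /eqP -> //; rewrite eq_sym; auto.
  have E2 : V2 = t ^+ 2 * V3.
    have V10 : V1 != 0 by apply: contra_eq_neq m13 => ->; rewrite mul0r eq_sym sqrf_eq0.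
    by apply: (mulfI V10); rewrite m12 mulrCA m13 exprMn.
  have t2 : t ^+ 2 != 0 by rewrite sqrf_eq0.
  have : V3 ^+ 2 == v 5 ^+ 2.
    by apply/eqP/(mulfI t2); rewrite -[RHS]exprMn -m23 E2; ring.
  rewrite eqf_sqr => /orP[] /eqP E3.
    have E1 : V1 = v 5 by apply: (mulIf v5); rewrite -{1}E3 m13 expr2.
    apply: (ex 5) => // j; rewrite !inE => /or4P[||| /or3P[]] /eqP -> // _.
    - by move: E1; rewrite /V1 v4; lra.
    - by move: E2; rewrite E3 /V2 v4; lra.
    - by move: E3; rewrite /V3; lra.
  (* The diagonal with the wrong sign passes all 2-minors; only the 3-minor excludes it. The case of
     nonzero [v 4] below is similar. *)
  have E1 : V1 = - v 5 by apply: (mulIf v5); move: m13; rewrite E3; lra.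
  have : 4 * (t ^+ 2 * v 5 ^+ 3) = 0 by move: m123; rewrite E2 E1 E3; lra.
  by move/eqP; rewrite !(mulf_eq0, expf_eq0) (negPf t0) (negPf v5).
have v5 : v 5 = 0 by apply: sqr0; rewrite -m13 E0 mulr0.
have v3 : v 3 = 0 by rewrite -E0 /V3 v5 addr0.
rewrite !v5 ?mulr0 ?addr0 in m12 m012.
have [v4|v4] := eqVneq (v 4) 0.
  have [||| i [i3 i0 i1 i2]] := @diag3 0%N 1%N 2.
  - by move: m01; rewrite /V0 /V1 v4 v5 !addr0 expr0n.
  - by move: m02; rewrite /V0 /V2 v4 v5 !mulr0 !addr0 expr0n.
  - by move: m12; rewrite /V1 /V2 v4 v5 !mulr0 !addr0 expr0n.
  apply: (ex i); first by move: i3; rewrite !inE => /or3P[] /eqP ->.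
  move=> j; rewrite !inE => /or4P[||| /or3P[]] /eqP -> //; rewrite eq_sym; auto.
have E2 : V2 = V1.
  have V00 : V0 != 0 by apply: contra_eq_neq m01 => ->; rewrite mul0r eq_sym sqrf_eq0.
  by apply: (mulfI V00); rewrite m01 m02.
have : V1 ^+ 2 == v 4 ^+ 2 by rewrite -m12 E2 expr2.
rewrite eqf_sqr => /orP[] /eqP E1.
  have E0' : V0 = v 4 by apply: (mulIf v4); rewrite -{1}E1 m01 expr2.
  apply: (ex 4) => // j; rewrite !inE => /or4P[||| /or3P[]] /eqP -> // _.
  - by move: E0'; rewrite /V0; lra.
  - by move: E1; rewrite /V1 v5; lra.
  - by move: E2; rewrite E1 /V2 v5; lra.
have E0' : V0 = - v 4 by apply: (mulIf v4); move: m01; rewrite E1; lra.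
have : 4 * (v 4 ^+ 3) = 0 by move: m012; rewrite E2 E1 E0'; lra.
by move/eqP; rewrite !(mulf_eq0, expf_eq0) (negPf v4).
Qed.

End Quartic.

(** * Contact equivalence of polynomial functions *)

Section ContactFunctions.
Import GRing.Theory.
Local Open Scope ring_scope.
Variable K : fieldType.

(* For C the matrix of a basis of W, this is psi_W as a function. *)
Definition gram_det r n (C : 'M[K]_(r, n)) (x : 'rV[K]_n) : K :=
  \det (C *m diag_mx x *m C^T).

Lemma gram_detMl r n (P : 'M[K]_r) (C : 'M[K]_(r, n)) x :
  gram_det (P *m C) x = \det P ^+ 2 * gram_det C x.
Proof.
have -> : gram_det (P *m C) x = \det (P *m (C *m diag_mx x *m C^T) *m P^T).
  by rewrite /gram_det trmx_mul !mulmxA.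
by rewrite !det_mulmx det_tr -/(gram_det C x); ring.
Qed.

(** Evaluation at a combination of r basis vectors isolates one squared minor. A repeated value of
    [f] gives 0 on both sides. *)
Lemma gram_det_colsub r n (C : 'M[K]_(r, n)) (f : 'I_r -> 'I_n) (b : 'I_r -> K) :
  gram_det C (\sum_j b j *: delta_mx 0 (f j))
  = \prod_j b j * \det (colsub f C) ^+ 2.
Proof.
have -> : gram_det C (\sum_j b j *: delta_mx 0 (f j))
   = \det (colsub f C *m diag_mx (\row_j b j) *m (colsub f C)^T).
  congr (\det _); apply/matrixP=> i i'; rewrite !mul_mx_diag !mxE.
  under eq_bigr => k _ do rewrite !mxE summxE mulr_sumr mulr_suml.
  rewrite exchange_big; apply: eq_bigr => j _.
  rewrite (bigD1 (f j)) //= big1 ?addr0 => [|k /negPf nk]; rewrite !mxE ?eqxx ?mulr1 //.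
  by rewrite nk !mulr0 mul0r.
rewrite !det_mulmx det_tr det_diag.
by under eq_bigr => j _ do rewrite mxE; ring.
Qed.

(** Contact equivalence of functions: [proj] forgets the additional variables, and [incl] is a
    section of it. *)
Definition fun_contact n (F G : 'rV[K]_n -> K) : Prop :=
  exists p (proj : 'M[K]_(p, n)) (incl : 'M[K]_(n, p)) (L : 'M[K]_p) (lambda : K),
  [/\ incl *m proj = 1%:M, L \in unitmx, lambda != 0
    & forall x, F (x *m proj) = lambda * G (x *m L *m proj)].

Lemma fun_contact_sym n (F G : 'rV[K]_n -> K) : fun_contact F G -> fun_contact G F.
Proof.
move=> [p [pr [ic [L [la [E Lu la0 FG]]]]]].
exists p, pr, ic, (invmx L), la^-1; split; rewrite ?unitmx_inv ?invr_eq0 //.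
by move=> x; rewrite FG mulmxKV // mulKf.
Qed.

Lemma fun_contact_scale n (F G F' G' : 'rV[K]_n -> K) c d :
  c != 0 -> d != 0 -> (forall x, F' x = c * F x) -> (forall x, G' x = d * G x) ->
  fun_contact F' G' -> fun_contact F G.
Proof.
move=> c0 d0 EF EG [p [pr [ic [L [la [E Lu la0 FG]]]]]].
exists p, pr, ic, L, (c^-1 * la * d); split=> //.
  by rewrite !mulf_neq0 ?invr_eq0.
by move=> x; apply: (mulfI c0); rewrite -EF FG EG; field.
Qed.

Definition affine_dir n (F : 'rV[K]_n -> K) v :=
  forall x s, F (x + s *: v) - F x = s * (F (x + v) - F x).

(** [M] is the inclusion followed by L and the projection. Since L is invertible, every base point
    for [G] lifts to p variables and comes from a base point for [F], so that affine directions are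
    transported. *)
Lemma fun_contactP n (F G : 'rV[K]_n -> K) : fun_contact F G ->
  exists (M : 'M[K]_n) lambda, [/\ lambda != 0, forall x, F x = lambda * G (x *m M)
    & forall v, affine_dir F v -> affine_dir G (v *m M)].
Proof.
move=> [p [pr [ic [L [la [E Lu la0 FG]]]]]].
exists (ic *m L *m pr), la; split=> //.
  by move=> x; rewrite !mulmxA -FG -mulmxA E mulmx1.
move=> v Fv y s; pose z := y *m ic *m invmx L.
have Gz c : G (y + c *: (v *m (ic *m L *m pr))) = la^-1 * F (z *m pr + c *: v).
  have -> : z *m pr + c *: v = (z + c *: (v *m ic)) *m pr.
    by rewrite mulmxDl -scalemxAl -(mulmxA v) E mulmx1.
  rewrite FG mulKf //; congr G.
  rewrite !mulmxDl mulmxKV // -(mulmxA y) E mulmx1; congr (_ + _).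
  by rewrite -!scalemxAl !mulmxA.
have Gz0 := Gz 0; rewrite !scale0r !addr0 in Gz0.
have Gz1 := Gz 1; rewrite !scale1r in Gz1.
by rewrite Gz Gz0 Gz1 -!mulrBr Fv; ring.
Qed.

(** Configuration polynomials number their variables by [enum_rank]; this permutation matrix returns
    to the indices in ['I_n]. *)
Definition ord_enum_mx n : 'M[K]_(#|'I_n|, n) :=
  \matrix_(k, j) (enum_val k == j)%:R.

Definition coord_mx r n (w : r.-tuple {ffun 'I_n -> K^o}) : 'M[K]_(r, n) :=
  \matrix_(i, j) (tnth w i j : K).

Lemma eval_config_poly r n (w : r.-tuple {ffun 'I_n -> K^o})
    (z : 'rV[K]_#|'I_n|) :
  (\det (config_matrix w)).@[z 0] = gram_det (coord_mx w) (z *m ord_enum_mx n).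
Proof.
rewrite -det_map_mx; congr (\det _); apply/matrixP=> i j.
rewrite mul_mx_diag !mxE rmorph_sum /=; apply: eq_bigr => e _.
rewrite mevalZ mevalXU !mxE (bigD1 (enum_rank e)) //= big1 ?addr0 => [|k nk].
  by rewrite !mxE enum_rankK eqxx mulr1; ring.
rewrite mxE; case: eqP => [ke|]; last by rewrite mulr0.
by rewrite -ke enum_valK eqxx in nk.
Qed.

Definition row_config r n (C : 'M[K]_(r, n)) : r.-tuple {ffun 'I_n -> K^o} :=
  [tuple [ffun j => C i j : K^o] | i < r].

Lemma coord_row_config r n (C : 'M[K]_(r, n)) : coord_mx (row_config C) = C.
Proof. by apply/matrixP=> i j; rewrite mxE tnth_mktuple ffunE. Qed.

Lemma row_config_free r n (C : 'M[K]_(r, n)) : row_free C -> free (row_config C).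
Proof.
move=> fC; apply/freeP=> k Ek; suff /rowP k0 : \row_i k i = 0.
  by move=> i; have := k0 i; rewrite !mxE.
apply: (row_free_inj fC); rewrite mul0mx; apply/rowP=> j; rewrite !mxE.
move/ffunP/(_ j): Ek; rewrite sum_ffunE ffunE => Ej.
rewrite -[RHS]Ej; apply: eq_bigr => i _.
by rewrite !mxE ffunE -tnth_nth tnth_mktuple ffunE.
Qed.

(** The factor is the squared determinant of the change of basis. With two sizes, a tuple indexed by
    [\dim W] can be compared with one of explicit size. *)
Lemma coord_basis_change r r' n W (b : r.-tuple {ffun 'I_n -> K^o})
    (w : r'.-tuple {ffun 'I_n -> K^o}) : r' = r ->
  basis_of W b -> basis_of W w ->
  exists2 c, c != 0 & forall x, gram_det (coord_mx w) x = c * gram_det (coord_mx b) x.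
Proof.
move=> rr; subst r'; move=> /andP[/eqP bW bf] /andP[/eqP wW wf].
pose P := \matrix_(i, j) coord b j (tnth w i).
have wE : coord_mx w = P *m coord_mx b.
  apply/matrixP=> i j; rewrite !mxE.
  have /coord_span Ew : tnth w i \in <<b>>%VS by rewrite bW -wW memv_span // mem_tnth.
  rewrite {1}Ew sum_ffunE; apply: eq_bigr => k _.
  by rewrite !mxE ffunE -tnth_nth.
exists (\det P ^+ 2); last by move=> x; rewrite wE gram_detMl.
rewrite expf_eq0 /= -unitfE -unitmxE -row_free_unit -kermx_eq0.
apply/eqP/row_matrixP=> i0; rewrite row0; set v := row i0 _.
apply/rowP=> i; rewrite [RHS]mxE; move/freeP: wf; apply=> {i}.
apply/ffunP=> e; rewrite sum_ffunE ffunE.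
have vP : v *m coord_mx w = 0.
  by rewrite wE mulmxA -row_mul mulmx_ker row0 mul0mx.
move/rowP/(_ e): vP; rewrite !mxE => vPe; rewrite -[RHS]vPe; apply: eq_bigr => j _.
by rewrite !mxE ffunE -tnth_nth.
Qed.

Lemma contact_equiv_fun n (phi psi : {mpoly K[#|'I_n|]}) (F G : 'rV[K]_n -> K) :
  (forall z : 'rV_#|'I_n|, phi.@[z 0] = F (z *m ord_enum_mx n)) ->
  (forall z : 'rV_#|'I_n|, psi.@[z 0] = G (z *m ord_enum_mx n)) ->
  contact_equiv phi psi -> fun_contact F G.
Proof.
move=> EF EG [p [le1 [le2 [l [la [lu la0 E]]]]]].
rewrite (bool_irrelevance le2 le1) in E *.
exists p, (widen_mx K le1 *m ord_enum_mx n),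
  ((ord_enum_mx n)^T *m (widen_mx K le1)^T), l^T, la.
have evalw (q : {mpoly K[#|'I_n|]}) (y : 'I_p -> K) :
    (mpoly_widen le1 q).@[y] = q.@[((\row_k y k) *m widen_mx K le1) 0].
  rewrite /mpoly_widen comp_mpoly_meval; apply: meval_eq => i.
  rewrite tnth_mktuple mevalXU mxE (bigD1 (widen_ord le1 i)) //= big1 ?addr0.
    by rewrite !mxE eqxx mulr1.
  by move=> k /negPf nk; rewrite !mxE nk mulr0.
split; rewrite ?unitmx_tr //.
  rewrite mulmxA -(mulmxA (ord_enum_mx n)^T) widen_mxK mulmx1.
  apply/matrixP=> i j; rewrite !mxE (bigD1 (enum_rank i)) //= big1 ?addr0.
    by rewrite !mxE enum_rankK eqxx mul1r.
  move=> k nk; rewrite !mxE; case: eqP => [ke|]; last by rewrite mul0r.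
  by rewrite -ke enum_valK eqxx in nk.
move=> x; rewrite !mulmxA -EF -EG.
have := congr1 (meval (x 0)) E.
rewrite evalw mevalZ /linear_subst comp_mpoly_meval evalw.
have -> : \row_k x 0 k = x by apply/rowP=> k; rewrite mxE.
move=> ->; congr (_ * _.@[_ 0]); congr (_ *m _).
apply/rowP=> i; rewrite !mxE tnth_mktuple rmorph_sum /=.
by apply: eq_bigr => j _; rewrite mevalZ mevalXU mxE mulrC.
Qed.

End ContactFunctions.

(** * Rank 4 + m: adding m coloops to [config4] *)

Section Family.
Import GRing.Theory Num.Theory Order.TTheory.
Local Open Scope ring_scope.
Variable m : nat.

Definition config_family (t : rat) : 'M[rat]_(4 + m, 6 + m) :=
  block_mx (config4 t) 0 0 1%:M.

(** [inord] assigns a default to the indices from 6 on, which [quartic] never reads. *)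
Definition head6 (x : 'rV[rat]_(6 + m)) (i : nat) : rat := x 0 (lshift m (inord i)).

Lemma gram_det_family t (x : 'rV[rat]_(6 + m)) :
  gram_det (config_family t) x = quartic t (head6 x) * \prod_j x 0 (rshift 6 j).
Proof.
rewrite -det_config4.
have -> : \prod_j x 0 (rshift 6 j) = \det (diag_mx (rsubmx x)).
  by rewrite det_diag; apply: eq_bigr => j _; rewrite mxE.
rewrite -(det_ublock _ 0); congr (\det _).
have {1}-> : x = row_mx (\row_k head6 x k) (rsubmx x).
  rewrite -{1}[x]hsubmxK; congr row_mx; apply/rowP=> k.
  by rewrite !mxE /head6 inord_val.
rewrite diag_mx_row /config_family tr_block_mx !mulmx_block.
by rewrite !(trmx0, mulmx0, mul0mx, addr0, add0r, trmx1, mulmx1, mul1mx).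
Qed.

Lemma head6D x y : head6 (x + y) =1 (fun i => head6 x i + head6 y i).
Proof. by move=> i; rewrite /head6 mxE. Qed.

Lemma head6Z c x : head6 (c *: x) =1 (fun i => c * head6 x i).
Proof. by move=> i; rewrite /head6 mxE. Qed.

Lemma quartic_ext t x y :
  (forall i, (i < 6)%N -> x i = y i) -> quartic t x = quartic t y.
Proof. by move=> xy; rewrite /quartic !xy. Qed.

(** The polynomial has degree at most one in each variable. *)
Lemma coord_affine t i : affine_dir (gram_det (config_family t)) (delta_mx 0 i).
Proof.
move=> x s; rewrite !gram_det_family.
have q c : quartic t (head6 (x + c *: delta_mx 0 i))
    = quartic t (fun k => head6 x k + c * head6 (delta_mx 0 i) k).
  by apply: quartic_ext => k _; rewrite head6D head6Z.
have -> : x + delta_mx 0 i = x + 1 *: delta_mx 0 i by rewrite scale1r.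
rewrite !q; case: (split_ordP i) => j ->.
  have p c : \prod_k (x + c *: delta_mx 0 (lshift m j)) 0 (rshift 6 k)
      = \prod_k x 0 (rshift 6 k).
    by apply: eq_bigr => k _; rewrite !mxE eq_rlshift andbF mulr0 addr0.
  rewrite !p -!mulrBl mulrA; congr (_ * _).
  have d k : (k < 6)%N -> head6 (delta_mx 0 (lshift m j)) k = (k == j)%:R.
    by move=> k6; rewrite /head6 mxE eqxx eq_lshift -(inj_eq val_inj) /= inordK.
  rewrite /quartic !d //.
  by case: j {q p d} => [[|[|[|[|[|[|//]]]]]] ?] /=; ring.
have d k : head6 (delta_mx 0 (rshift 6 j)) k = 0.
  by rewrite /head6 mxE eq_lrshift andbF.
have q' c : quartic t (fun k => head6 x k + c * head6 (delta_mx 0 (rshift 6 j)) k)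
   = quartic t (head6 x) by apply: quartic_ext => k _; rewrite d mulr0 addr0.
rewrite !q'.
have p c : \prod_k (x + c *: delta_mx 0 (rshift 6 j)) 0 (rshift 6 k)
   = (x 0 (rshift 6 j) + c) * \prod_(k | k != j) x 0 (rshift 6 k).
  rewrite (bigD1 j) //= !mxE !eqxx mulr1; congr (_ * _).
  by apply: eq_bigr => k /negPf nk; rewrite !mxE eq_rshift nk andbF mulr0 addr0.
have p0 : \prod_k x 0 (rshift 6 k)
   = x 0 (rshift 6 j) * \prod_(k | k != j) x 0 (rshift 6 k) by rewrite (bigD1 j).
by rewrite !p p0; ring.
Qed.

Definition glue (x : nat -> rat) (y : 'I_m -> rat) : 'rV[rat]_(6 + m) :=
  row_mx (\row_i x i) (\row_j y j).

Lemma gram_det_glue t v s x y :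
  gram_det (config_family t) (glue x y + s *: v)
  = quartic t (fun i => x i + s * head6 v i) * \prod_j (y j + s * v 0 (rshift 6 j)).
Proof.
rewrite gram_det_family; congr (_ * _); last first.
  by apply: eq_bigr => j _; rewrite mxE row_mxEr !mxE.
apply: quartic_ext => i i6; rewrite head6D head6Z; congr (_ + _).
by rewrite /head6 row_mxEl !mxE inordK.
Qed.

Lemma quartic_constant_dir t v : t != 0 ->
  (forall x s, quartic t (fun i => x i + s * v i) = quartic t x) ->
  forall i, (i < 6)%N -> v i = 0.
Proof.
move=> t0 cst.
have [|i i6 vi] := @quartic_affineP t v t0.
  by move=> x s; rewrite cst; have := cst x 1; rewrite /quartic !mul1r => ->; ring.
move=> j j6; have [->|/vi->//] := eqVneq j i.
(* The i-th point is the indicator of three columns that form a basis with column i, of squared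
   minor 1: the quartic is 0 there, and [v i] after the move along v. *)
have := cst (nth 0 (nth [::] [:: [:: 0; 1; 1; 1; 0; 0]; [:: 1; 0; 1; 1; 0; 0];
  [:: 1; 1; 0; 1; 0; 0]; [:: 1; 1; 1; 0; 0; 0]; [:: 0; 1; 1; 1; 0; 0];
  [:: 1; 0; 1; 1; 0; 0]] i)) 1.
have vE k : (k < 6)%N -> v k = if k == i then v i else 0.
  by move=> k6; case: eqVneq => [->|/(vi _ k6)].
case: i i6 vi vE => [|[|[|[|[|[|//]]]]]] _ _ vE;
  rewrite /quartic (vE 0) // (vE 1) // (vE 2) // (vE 3) // (vE 4) // (vE 5) //=; lra.
Qed.

(** If v has no coloop component, this is [quartic_affineP]. If its component at the coloop k is
    nonzero, points with k-th coloop coordinate 0 split off the factor [s * a k]; the remaining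
    factor is then constant along v, which kills all other components. *)
Lemma affine_coord t v : t != 0 -> affine_dir (gram_det (config_family t)) v ->
  exists i a, v = a *: delta_mx 0 i.
Proof.
move=> t0 aff; pose a j := v 0 (rshift 6 j).
have affE x y s : quartic t (fun i => x i + s * head6 v i)
    * \prod_j (y j + s * a j) - quartic t x * \prod_j y j
  = s * (quartic t (fun i => x i + head6 v i) * \prod_j (y j + a j)
        - quartic t x * \prod_j y j).
  have G0 : gram_det (config_family t) (glue x y) = quartic t x * \prod_j y j.
    rewrite -[glue x y]addr0 -(scale0r v) gram_det_glue; congr (_ * _).
      by apply: quartic_ext => i _; rewrite mul0r addr0.
    by apply: eq_bigr => j _; rewrite mul0r addr0.
  have G1 : gram_det (config_family t) (glue x y + v)
      = quartic t (fun i => x i + head6 v i) * \prod_j (y j + a j).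
    rewrite -[v in glue x y + v]scale1r gram_det_glue; congr (_ * _).
      by apply: quartic_ext => i _; rewrite mul1r.
    by apply: eq_bigr => j _; rewrite mul1r.
  by rewrite -G0 -G1 -aff gram_det_glue.
case: (pickP (fun j => a j != 0)) => [k ak|a0]; last first.
  have {}a0 j : a j = 0 by apply/eqP; have := a0 j; case: eqP.
  have [|i i6 vi] := @quartic_affineP t (head6 v) t0.
    move=> x s; have := affE x (fun=> 1) s.
    under eq_bigr do rewrite a0 mulr0 addr0.
    under [X in s * (_ * X - _)]eq_bigr do rewrite a0 addr0.
    by rewrite !big1_eq !mulr1.
  exists (lshift m (Ordinal i6)), (head6 v i); apply/rowP=> l; rewrite !mxE.
  case: (split_ordP l) => j -> /=; last first.
    by rewrite eq_rlshift mulr0; apply: a0.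
  rewrite eq_lshift -[j == _]/(j == i :> nat); case: eqP => [ji|/eqP ji].
    by rewrite mulr1 /head6 -ji inord_val.
  by rewrite mulr0; have := vi j (ltn_ord j) ji; rewrite /head6 inord_val.
have step x y s : s != 0 -> quartic t (fun i => x i + s * head6 v i)
      * \prod_(j | j != k) (y j + s * a j)
    = quartic t (fun i => x i + head6 v i) * \prod_(j | j != k) (y j + a j).
  move=> s0; pose y' j := if j == k then 0 else y j.
  have := affE x y' s.
  have p0 : \prod_j y' j = 0 by rewrite (bigD1 k) //= {1}/y' eqxx mul0r.
  have p1 c : \prod_j (y' j + c * a j) = c * a k * \prod_(j | j != k) (y j + c * a j).
    rewrite (bigD1 k) //= {1}/y' eqxx add0r; congr (_ * _).
    by apply: eq_bigr => j /negPf nj; rewrite /y' nj.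
  have p2 : \prod_j (y' j + a j) = a k * \prod_(j | j != k) (y j + a j).
    rewrite (bigD1 k) //= {1}/y' eqxx add0r; congr (_ * _).
    by apply: eq_bigr => j /negPf nj; rewrite /y' nj.
  rewrite p0 p1 p2 !mulr0 !subr0 => E.
  by apply: (mulfI (mulf_neq0 s0 ak)); rewrite mulrCA E; ring.
have al l : l != k -> a l = 0.
  (* The factor at l is [a l] for s = 2 and 0 for s = 1, while for s = 2 the quartic and all other
     factors are 1. *)
  move=> lk; pose y j := if j == l then - a l else 1 - 2 * a j.
  have := step (fun i => nth 0 [:: 1; 1; 1; 1; 0; 0] i - 2 * head6 v i) y 2 isT.
  have -> : quartic t (fun i => nth 0 [:: 1; 1; 1; 1; 0; 0] i - 2 * head6 v i
      + 2 * head6 v i) = 1.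
    by rewrite /quartic /=; ring.
  rewrite (bigD1 l) //= [X in _ = _ * X](bigD1 l) //= /y eqxx addNr mul0r mulr0.
  rewrite big1 => [|j /andP[_ /negPf ->]]; last by rewrite subrK.
  by lra.
have v0 : forall i, (i < 6)%N -> head6 v i = 0.
  apply: (quartic_constant_dir t0).
  have st x s : s != 0 -> quartic t (fun i => x i + s * head6 v i)
      = quartic t (fun i => x i + head6 v i).
    move=> s0; have := step x (fun=> 1) s s0.
    rewrite !big1 ?mulr1 // => j /al ->; rewrite ?mulr0 ?addr0 //.
  have sub x : quartic t (fun i => x i - head6 v i + head6 v i) = quartic t x.
    by apply: quartic_ext => i _; rewrite subrK.
  (* [st] excludes s = 0. Starting from x - v reaches x at parameter 1 and the target at s + 1; for
     s = -1, the base point x - 2v serves instead. *)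
  move=> x s; have [->|s1] := eqVneq s (- 1).
    have e := st (fun i => x i - 2 * head6 v i) 2 isT.
    have -> : quartic t x = quartic t (fun i => x i - 2 * head6 v i + 2 * head6 v i).
      by apply: quartic_ext => i _; rewrite subrK.
    by rewrite e; apply: quartic_ext => i _; ring.
  have := st (fun i => x i - head6 v i) (s + 1); rewrite sub => <-.
    by apply: quartic_ext => i _; ring.
  by rewrite addr_eq0.
exists (rshift 6 k), (a k); apply/rowP=> l; rewrite !mxE.
case: (split_ordP l) => j -> /=.
  by rewrite eq_lrshift mulr0 -(v0 j (ltn_ord j)) /head6 inord_val.
rewrite eq_rshift; case: eqP => [->|/eqP/al]; rewrite ?mulr1 //.
by rewrite mulr0.
Qed.

End Family.

(** * An infinite family *)

Section Moduli.
Import GRing.Theory Num.Theory Order.TTheory.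
Local Open Scope ring_scope.
Variable m : nat.

(** Ordered selections with repetitions form a finite type. The order disappears in squared minors,
    and a repeated column gives 0. *)
Definition columns := {ffun 'I_(4 + m) -> 'I_(6 + m)}.

Definition sq_minor (t : rat) (f : columns) : rat :=
  \det (colsub f (config_family m t)) ^+ 2.

(** The denominator comes from [f.1]; if it is zero, the ratio is 0. *)
Definition minor_ratio t (f : columns * columns * (columns * columns)) : rat :=
  sq_minor t f.2.1 * sq_minor t f.2.2 / (sq_minor t f.1.1 * sq_minor t f.1.2).

Definition ratio_bound (t : rat) : nat := \sum_f Num.bound `|minor_ratio t f|.

Lemma le_ratio_bound t f : minor_ratio t f <= (ratio_bound t)%:R.
Proof.
apply: le_trans (ler_norm _) _; apply: ltW.
apply: lt_le_trans (archi_boundP (normr_ge0 _)) _.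
by rewrite ler_nat /ratio_bound (bigD1 f) //= leq_addr.
Qed.

Definition basis_columns (l : seq nat) (j : 'I_(4 + m)) : 'I_(6 + m) :=
  match split j with
  | inl i => lshift m (inord (nth 0%N l i))
  | inr k => rshift 6 k
  end.

Lemma gram_det_basis_columns t l : all (fun k => k < 6)%N l -> size l = 4 ->
  gram_det (config_family m t) (\sum_j delta_mx 0 (basis_columns l j))
  = quartic t (fun k => \sum_(i < 4) (k == nth 0%N l i)%:R).
Proof.
move=> /allP l6 sl; rewrite gram_det_family big_split_ord /=.
have lE (i : 'I_4) : basis_columns l (lshift m i) = lshift m (inord (nth 0%N l i)).
  by rewrite /basis_columns -[lshift m i]/(unsplit (inl i)) unsplitK.
have rE k : basis_columns l (rshift 4 k) = rshift 6 k.
  by rewrite /basis_columns -[rshift 4 k]/(unsplit (inr k)) unsplitK.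
rewrite [X in _ * X]big1 => [|j _]; last first.
  rewrite mxE !summxE big1 ?add0r => [|i _]; last by rewrite lE mxE eq_rlshift andbF.
  rewrite (bigD1 j) //= big1 ?addr0 => [|k nk]; first by rewrite rE mxE !eqxx.
  by rewrite rE mxE eq_rshift eq_sym (negPf nk) andbF.
rewrite mulr1; apply: quartic_ext => k k6; rewrite /head6 mxE !summxE.
rewrite [X in _ + X]big1 ?addr0 => [|j _]; last by rewrite rE mxE eq_lrshift andbF.
apply: eq_bigr => i _; rewrite lE mxE eqxx eq_lshift -(inj_eq val_inj) /= !inordK //.
by apply: l6; rewrite mem_nth ?sl.
Qed.

(** At the indicator of the columns 0, 1, 2, 3 and of all coloops, the quartic is 1. The Gram matrix
    is invertible there and yields a right inverse. *)
Lemma config_family_free t : row_free (config_family m t).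
Proof.
have := @gram_det_basis_columns t [:: 0; 1; 2; 3]%N isT erefl.
set x := \sum_j _; rewrite /quartic !big_ord_recl !big_ord0 /= => E. have u : config_family m t *m diag_mx x *m (config_family m t)^T \in unitmx.
  rewrite unitmxE unitfE -/(gram_det _ _) E; apply/eqP; lra.
apply/row_freeP; exists (diag_mx x *m (config_family m t)^T *m invmx
   (config_family m t *m diag_mx x *m (config_family m t)^T)).
by rewrite !mulmxA mulmxV.
Qed.

Lemma contact_family_bound s t : s != 0 ->
  fun_contact (gram_det (config_family m t)) (gram_det (config_family m s)) ->
  t ^+ 2 <= (ratio_bound s)%:R.
Proof.
move=> s0 /fun_contactP[M [la [la0 FG aff]]].
have mono i : exists ja : 'I_(6 + m) * rat,
    (delta_mx 0 i : 'rV[rat]_(6 + m)) *m M = ja.2 *: delta_mx 0 ja.1.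
  have [j [a E]] := affine_coord s0 (aff _ (coord_affine t i)).
  by exists (j, a).
have [sg sgE] := fin_all_exists mono.
pose A l := \prod_j (sg (basis_columns l j)).2.
pose f l : columns := [ffun j => (sg (basis_columns l j)).1].
have key l : all (fun k => k < 6)%N l -> size l = 4 ->
    quartic t (fun k => \sum_(i < 4) (k == nth 0%N l i)%:R)
    = la * (A l * sq_minor s (f l)).
  move=> l6 sl; rewrite -gram_det_basis_columns // FG mulmx_suml.
  under eq_bigr do rewrite sgE.
  rewrite gram_det_colsub /sq_minor; congr (_ * (_ * \det _ ^+ 2)).
  by apply/matrixP=> i j; rewrite !mxE ffunE.
(* The bases 0235 and 0134 have the same union with multiplicities as 0135 and 0234, so the scalars
   cancel ([AE]). The coefficient at 0135 is t^2, the other three are 1. *)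
have e1 := key [:: 0; 2; 3; 5]%N isT erefl.
have e2 := key [:: 0; 1; 3; 4]%N isT erefl.
have e3 := key [:: 0; 1; 3; 5]%N isT erefl.
have e4 := key [:: 0; 2; 3; 4]%N isT erefl.
have AE : A [:: 0; 2; 3; 5]%N * A [:: 0; 1; 3; 4]%N
        = A [:: 0; 1; 3; 5]%N * A [:: 0; 2; 3; 4]%N.
  rewrite /A !big_split_ord /= !big_ord_recl !big_ord0.
  have lE l (i : 'I_4) : basis_columns l (lshift m i) = lshift m (inord (nth 0%N l i)).
    by rewrite /basis_columns -[lshift m i]/(unsplit (inl i)) unsplitK.
  have rE l : \prod_j (sg (basis_columns l (rshift 4 j))).2
      = \prod_(j < m) (sg (rshift 6 j)).2.
    apply: eq_bigr => j _.
    by rewrite /basis_columns -[rshift 4 j]/(unsplit (inr j)) unsplitK.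
  by rewrite !rE !lE /=; ring.
rewrite /quartic !big_ord_recl !big_ord0 /= in e1 e2 e3 e4.
move: AE e1 e2 e3 e4.
set m1 := sq_minor s (f [:: 0; 2; 3; 5]%N); set m2 := sq_minor s (f [:: 0; 1; 3; 4]%N).
set m3 := sq_minor s (f [:: 0; 1; 3; 5]%N); set m4 := sq_minor s (f [:: 0; 2; 3; 4]%N).
set a1 := A _; set a2 := A _; set a3 := A _; set a4 := A _ => AE e1 e2 e3 e4.
have {}e1 : la * (a1 * m1) = 1 by rewrite -e1; ring.
have {}e2 : la * (a2 * m2) = 1 by rewrite -e2; ring.
have {}e3 : la * (a3 * m3) = t ^+ 2 by rewrite -e3; ring.
have {}e4 : la * (a4 * m4) = 1 by rewrite -e4; ring.
have m10 : m1 != 0 by apply: contra_eq_neq e1 => ->; rewrite !mulr0 eq_sym oner_neq0.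
have m20 : m2 != 0 by apply: contra_eq_neq e2 => ->; rewrite !mulr0 eq_sym oner_neq0.
have m12 := mulf_neq0 m10 m20.
suff -> : t ^+ 2 = minor_ratio s ((f [:: 0; 2; 3; 5]%N, f [:: 0; 1; 3; 4]%N),
    (f [:: 0; 1; 3; 5]%N, f [:: 0; 2; 3; 4]%N)) by apply: le_ratio_bound.
apply: (mulIf m12); rewrite /minor_ratio /= -/m1 -/m2 -/m3 -/m4 divfK //.
transitivity ((la * (a3 * m3)) * (la * (a4 * m4)) * (m1 * m2)).
  by rewrite e3 e4 mulr1.
transitivity (la ^+ 2 * (a3 * a4) * (m1 * m2) * (m3 * m4)); first by ring.
rewrite -AE; transitivity ((la * (a1 * m1)) * (la * (a2 * m2)) * (m3 * m4)).
  by ring.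
by rewrite e1 e2 !mul1r.
Qed.

(** Each term exceeds the [ratio_bound] of all earlier ones, since the sum includes the previous
    term; the start at 1 keeps all parameters nonzero. *)
Fixpoint parameter (k : nat) : nat :=
  if k is k'.+1 then (parameter k' + ratio_bound (parameter k')%:R).+1 else 1.

Lemma ltn_parameter k l : (k < l)%N -> (ratio_bound (parameter k)%:R < parameter l)%N.
Proof.
elim: l => // l IH; rewrite ltnS leq_eqVlt => /orP[/eqP->|/IH lt] /=.
  by rewrite ltnS leq_addl.
by rewrite ltnS (leq_trans (ltnW lt)) // leq_addr.
Qed.

Lemma parameter_gt0 k : (0 < parameter k)%N.
Proof. by case: k. Qed.

Definition config_space k : {vspace {ffun 'I_(6 + m) -> rat^o}} :=
  <<row_config (config_family m (parameter k)%:R)>>%VS.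

Lemma config_space_basis k :
  basis_of (config_space k) (row_config (config_family m (parameter k)%:R)).
Proof. by rewrite /basis_of eqxx row_config_free ?config_family_free. Qed.

Lemma dim_config_space k : \dim (config_space k) = (4 + m)%N.
Proof. by rewrite (size_basis (config_space_basis k)). Qed.

Lemma config_space_contact k l (phi psi : {mpoly rat[#|'I_(6 + m)|]}) :
  is_config_poly (config_space k) phi -> is_config_poly (config_space l) psi ->
  contact_equiv phi psi ->
  fun_contact (gram_det (config_family m (parameter k)%:R))
              (gram_det (config_family m (parameter l)%:R)).
Proof.
move=> [w bw ->] [w' bw' ->] E.
have [c c0 Ec] := coord_basis_change (dim_config_space k) (config_space_basis k) bw.
have [d d0 Ed] := coord_basis_change (dim_config_space l) (config_space_basis l) bw'.
rewrite !coord_row_config in Ec Ed.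
apply: (fun_contact_scale c0 d0 Ec Ed).
by apply: contact_equiv_fun E; apply: eval_config_poly.
Qed.

Lemma config_space_not_contact k l (phi psi : {mpoly rat[#|'I_(6 + m)|]}) :
  k <> l -> is_config_poly (config_space k) phi ->
  is_config_poly (config_space l) psi -> ~ contact_equiv phi psi.
Proof.
move=> kl cphi cpsi /(config_space_contact cphi cpsi) E.
(* The bound is not symmetric: it fails with the larger parameter as t, since then [ratio_bound s] <
   t <= t^2. Symmetry of [fun_contact] handles the other order. *)
have absurd i j : (i < j)%N ->
    ~ fun_contact (gram_det (config_family m (parameter j)%:R))
                  (gram_det (config_family m (parameter i)%:R)).
  move=> ij /contact_family_bound; rewrite pnatr_eq0 -lt0n parameter_gt0 => /(_ isT).
  rewrite -natrX ler_nat leqNgt (leq_trans (ltn_parameter ij)) //.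
  by rewrite -{1}[parameter j]expn1 leq_pexp2l ?parameter_gt0.
case: (ltngtP k l) => // [kl'|lk]; last exact: absurd lk E.
exact: absurd kl' (fun_contact_sym E).
Qed.

End Moduli.

Theorem theorem1p2 :
  (forall K : fieldType,
     exists (N : nat) (phi : 'I_N -> {n : nat & {mpoly K[n]}}),
       forall (E : finType) (W : {vspace {ffun E -> K^o}})
              (psi : {mpoly K[#|E|]}),
         \dim W <= 3 -> is_config_poly W psi ->
         exists i : 'I_N, contact_equiv psi (projT2 (phi i)))
  /\
  (forall r : nat, 4 <= r ->
     exists (E : nat -> finType)
            (W : forall k : nat, {vspace {ffun E k -> rat^o}}),
       (forall k : nat, \dim (W k) = r) /\
       (forall (k l : nat)
               (phi : {mpoly rat[#|E k|]}) (psi : {mpoly rat[#|E l|]}),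
          k <> l -> is_config_poly (W k) phi -> is_config_poly (W l) psi ->
          ~ contact_equiv phi psi)).
Proof.
split=> [K | r /subnKC <-]; first exact: finitely_many_classes.
exists (fun=> 'I_(6 + (r - 4))), (config_space (r - 4)); split=> [k | k l phi psi].
  exact: dim_config_space.
exact: config_space_not_contact.
Qed.
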